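(* Let $1\leq p_j\leq\infty$ for $1\leq j\leq n$ satisfy $\sum_{j=1}^n p_j^{-1}=\frac{2^n-n}{2^{n-1}}$. Fix $\phi\in C_0^\infty(\mathbb{R}^2)$ and $a_1,\dots,a_n\in\mathbb{R}^2\setminus\{0\}$ lying in general position. Then, for all phases $S(x,y)$ which are real-analytic in a neighborhood of $0$, there exists $C>0$ such that for all $\lambda\geq 1$ the $n$-linear functional $$\Lambda_n(f_1,\dots,f_n)=\int_{\mathbb{R}^2}e^{i\lambda S(x,y)}\prod_{j=1}^n f_j(a_j\cdot(x,y))\,\phi(x,y)\,dx\,dy,$$ regarded as a map $L^{p_1}(\mathbb{R})\times\cdots\times L^{p_n}(\mathbb{R})\to\mathbb{C}$, has operator norm $\|\Lambda_n\|\geq C|\lambda|^{-\frac{1}{2^{n-1}}}$.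
   Context: Here $n$ is a positive integer (the number of functions), $\phi$ is a cutoff function containing the origin in its support, and the phase $S:\mathbb{R}^2\to\mathbb{R}$ is a real-valued measurable function. Vectors $a_1,\dots,a_n\in\mathbb{R}^2\setminus\{0\}$ lie in general position if no $a_i$ is a scalar multiple of $a_j$ for $i\neq j$. The functions $f_j:\mathbb{R}\to\mathbb{C}$ are complex-valued. The operator norm $\|\Lambda_n\|$ is the supremum of $|\Lambda_n(f_1,\dots,f_n)|/\prod_{j=1}^n\|f_j\|_{p_j}$ over nonzero $f_j\in L^{p_j}(\mathbb{R})$ for which the integral converges absolutely (the value $+\infty$ being allowed). By convention $1/\infty=0$.
   Formalization: The formal theorem assumes n ≥ 2: for n = 1 (so p_1 = 1) the claim fails, e.g. S(x,y) = y, a_1 = (1,0), φ a product of bumps gives ‖Λ_1‖ = O(λ^{-N}) for every N. The measurability of S is read as Borel measurability. *)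

(* Defs.v *)
From HB Require Import structures.
From mathcomp Require Import all_boot all_order all_algebra.
From mathcomp Require Import all_classical all_reals all_analysis.
From mathcomp Require Import complex.

Set Implicit Arguments.
Unset Strict Implicit.
Unset Printing Implicit Defensive.

Import Order.TTheory GRing.Theory Num.Theory.
Import numFieldNormedType.Exports.

Local Open Scope classical_set_scope.
Local Open Scope ring_scope.
Local Open Scope complex_scope.

Section Analysis2D.
Context {R : realType}.

(* Absolute convergence makes the order of summation irrelevant; the sum is
   taken along square partial sums. *)
Definition analytic_at (S : R * R -> R) (z : R * R) : Prop :=
  exists (c : nat -> nat -> R) (r : R), 0 < r /\
    forall h k : R, `|h| < r -> `|k| < r ->
      summable [set: nat * nat]
        (fun ij => (c ij.1 ij.2 * h ^+ ij.1 * k ^+ ij.2)%:E) /\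
      (fun N => \sum_(i < N) \sum_(j < N) c i j * h ^+ i * k ^+ j)
        @ \oo --> S (z.1 + h, z.2 + k).

(* Partial derivatives are the directional derivatives along (1, 0), (0, 1). *)
Fixpoint Ck (k : nat) (f : R^o * R^o -> R^o) : Prop :=
  continuous f /\
  if k is k'.+1 then
    [/\ forall z, derivable f z (1, 0), forall z, derivable f z (0, 1),
        Ck k' ('D_(1, 0) f) & Ck k' ('D_(0, 1) f)]
  else True.

Definition csupport (phi : R * R -> R[i]) : set (R * R) :=
  closure [set z | phi z != 0].

Definition test_function (phi : R * R -> R[i]) : Prop :=
  (forall k, Ck k (fun z => complex.Re (phi z)) /\ Ck k (fun z => complex.Im (phi z))) /\
  compact (csupport phi).

End Analysis2D.

Section ComplexIntegration.
Context {d : measure_display} {T : measurableType d} {R : realType}.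
Variable mu : {measure set T -> \bar R}.

Definition cmeasurable (g : T -> R[i]) : Prop :=
  measurable_fun setT (fun x => complex.Re (g x)) /\
  measurable_fun setT (fun x => complex.Im (g x)).

Definition cLnorm (p : \bar R) (g : T -> R[i]) : \bar R :=
  Lnorm mu p (fun x => (Normc.normc (g x))%:E).

Definition in_cLp (p : \bar R) (g : T -> R[i]) : Prop :=
  cmeasurable g /\ (cLnorm p g < +oo)%E.

Definition abs_convergent (g : T -> R[i]) : Prop :=
  cmeasurable g /\ (\int[mu]_x (Normc.normc (g x))%:E < +oo)%E.

Definition cintegral (g : T -> R[i]) : R[i] :=
  Rintegral mu setT (fun x => complex.Re (g x)) +i*
  Rintegral mu setT (fun x => complex.Im (g x)).

End ComplexIntegration.

Section Functional.
Context {R : realType} (n : nat).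

Definition leb1 : {measure set _ -> \bar R} := @lebesgue_measure R.
Definition leb2 : {measure set _ -> \bar R} :=
  (@lebesgue_measure R \x @lebesgue_measure R)%E.

Definition dot (a z : R * R) : R := a.1 * z.1 + a.2 * z.2.

Definition expi (t : R) : R[i] := cos t +i* sin t.

Definition general_position (a : 'I_n -> R * R) : Prop :=
  forall i j, i != j -> forall t : R, a i <> (t * (a j).1, t * (a j).2).

Variables (a : 'I_n -> R * R) (phi : R * R -> R[i]) (S : R * R -> R).
Variable lambda : R.

Definition integrand (f : 'I_n -> R -> R[i]) (z : R * R) : R[i] :=
  expi (lambda * S z) * (\prod_(j < n) f j (dot (a j) z)) * phi z.

Definition Lambda (f : 'I_n -> R -> R[i]) : R[i] :=
  cintegral leb2 (integrand f).

Definition admissible (p : 'I_n -> \bar R) (f : 'I_n -> R -> R[i]) : Prop :=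
  (forall j, in_cLp leb1 (p j) (f j) /\ ~ {ae leb1, forall t, f j t = 0}) /\
  abs_convergent leb2 (integrand f).

Definition opnorm (p : 'I_n -> \bar R) : \bar R :=
  ereal_sup [set ((Normc.normc (Lambda f))%:E / \prod_(j < n) cLnorm leb1 (p j) (f j))%E
            | f in [set f | admissible p f]].

End Functional.

(* Main.v *)
(* Near a point z0 with phi z0 <> 0 where S is analytic, the Taylor polynomial
   of S of degree < n is a sum of ridge polynomials q_j(a_j . (z - z0)): the n
   directions being pairwise independent, the powers (a_j . z)^m span the forms
   of degree m for each m < n. Take for f_j the indicator of the interval of
   radius w centred at a_j . z0, modulated by exp(-i lambda q_j). With
   w = eps lambda^(-1/n) the remaining phase is lambda O(w^n), hence small, so
   |Lambda| is at least of order w^2, whereas the product of the norms is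
   (2w)^(2 - n/2^(n-1)). *)
Require Import Defs.
From HB Require Import structures.
From mathcomp Require Import all_boot all_order all_algebra.
From mathcomp Require Import all_classical all_reals all_analysis.
From mathcomp Require Import measurable_realfun ess_sup_inf complex ring lra.

Set Implicit Arguments.
Unset Strict Implicit.
Unset Printing Implicit Defensive.

Import Order.TTheory GRing.Theory Num.Theory.
Import numFieldNormedType.Exports.

Local Open Scope classical_set_scope.
Local Open Scope ring_scope.
Local Open Scope complex_scope.

(** * Forms in two variables as sums of powers of linear forms *)

(** Row [l] of the matrix [M] lists the coefficients of the [m]-th power of the [l]-th linear form,
    so it suffices that the rows span. By duality, a vector orthogonal to all rows gives a
    polynomial of degree at most [m] vanishing at [n > m] distinct slopes, a vertical direction
    counting as a root at infinity; such a polynomial is zero. *)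
Lemma monomial_span (F : numFieldType) (n : nat) (a : 'I_n -> F * F) :
  (forall j, a j <> (0, 0)) ->
  (forall i j, i != j -> forall t : F, a i <> (t * (a j).1, t * (a j).2)) ->
  forall i j, (i + j < n)%N ->
  exists b : 'I_n -> F, forall x y,
    x ^+ i * y ^+ j = \sum_l b l * ((a l).1 * x + (a l).2 * y) ^+ (i + j).
Proof.
move=> a0 gp i j; set m := (i + j)%N => mn.
pose M : 'M[F]_(n, m.+1) :=
  \matrix_(l, k) ((a l).1 ^+ (m - k) * (a l).2 ^+ k *+ 'C(m, k)).
have fullM : row_full M.
  rewrite /row_full -mxrank_tr; apply: inj_row_free => v vM.
  pose P := \poly_(k < m.+1) (v 0 (inord k) *+ 'C(m, k)).
  have vMl l : \sum_(k < m.+1)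
      P`_k * ((a l).1 ^+ (m - k) * (a l).2 ^+ k) = 0.
    have := congr1 (fun A : 'M[F]_(1, n) => A 0 l) vM; rewrite !mxE => vMl.
    rewrite -[RHS]vMl; apply: eq_bigr => k _.
    by rewrite coef_poly ltn_ord inord_val !mxE mulrnAl mulrnAr.
  have rootP l : (a l).1 != 0 -> root P ((a l).2 / (a l).1).
    move=> al0; rewrite /root horner_poly.
    have: (a l).1 ^+ m * \sum_(k < m.+1)
        (v 0 (inord k) *+ 'C(m, k)) * ((a l).2 / (a l).1) ^+ k = 0.
      rewrite -[RHS](vMl l) mulr_sumr; apply: eq_bigr => k _.
      rewrite coef_poly ltn_ord expr_div_n -{1}(subnK (leq_ord k)) exprD.
      by rewrite mulrCA -mulrA [_ ^+ k * (_ / _)]mulrC divfK ?expf_neq0.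
    by move/eqP; rewrite mulf_eq0 expf_eq0 (negPf al0) andbF.
  (* Unless P = 0, it has too many roots: a direction with vanishing first
     coordinate, of which there is at most one, gives no root but lowers the
     degree of P instead. *)
  suff P0 : P = 0.
    (* In characteristic 0 the binomial factors are invertible, so [P = 0] forces [v = 0]. *)
    apply/rowP => k; rewrite mxE.
    have := congr1 (fun p : {poly F} => p`_k) P0.
    rewrite coef0 coef_poly ltn_ord inord_val => /eqP.
    by rewrite mulrn_eq0 -leqn0 leqNgt bin_gt0 leq_ord /= => /eqP.
  apply/eqP; apply/negPn/negP => P0.
  pose s := [seq l <- enum 'I_n | (a l).1 != 0].
  pose rs := [seq (a l).2 / (a l).1 | l <- s].
  have rsP : all (root P) rs.
    by apply/allP => _ /mapP[l + ->]; rewrite mem_filter => /andP[/rootP].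
  have rsU : uniq rs.
    rewrite map_inj_in_uniq; first exact/filter_uniq/enum_uniq.
    move=> k l.
    rewrite !mem_filter => /andP[k0 _] /andP[l0 _] kl.
    apply/eqP; apply/negPn/negP => /gp /(_ ((a k).1 / (a l).1)); apply.
    by rewrite divfK// mulrAC -mulrA -kl mulrCA divff// mulr1 -surjective_pairing.
  have := max_poly_roots P0 rsP rsU; rewrite size_map.
  have [l /eqP al0|alN0] := pickP (fun l => (a l).1 == 0); last first.
    have -> : s = enum 'I_n by apply/all_filterP/allP => l _; rewrite alN0.
    rewrite size_enum_ord => /leq_trans /(_ (size_poly _ _)).
    by rewrite ltnS leqNgt mn.
  have Pm0 : P`_m = 0.
    have := vMl l; rewrite big_ord_recr/= big1 ?add0r => [|k _]; last first.
      by rewrite al0 expr0n subn_eq0 leqNgt ltn_ord mul0r mulr0.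
    move/eqP; rewrite subnn expr0 mul1r mulf_eq0 => /orP[/eqP//|].
    rewrite expf_eq0 => /andP[_ /eqP al20].
    by case: (a0 l); rewrite (surjective_pairing (a l)) al0 al20.
  have sP : (size P <= m)%N.
    apply/leq_sizeP => k; rewrite leq_eqVlt => /orP[/eqP <-//|mk].
    by rewrite nth_default// (leq_trans (size_poly _ _)).
  have sE : s = rem l (enum 'I_n).
    rewrite rem_filter ?enum_uniq//; apply: eq_filter => k /=.
    apply/idP/idP; first by apply: contraNneq => ->; rewrite al0.
    apply: contraNneq => ak0; apply: contraT => kl.
    have al2 : (a l).2 != 0.
      apply: contra_notN (a0 l) => /eqP al20.
      by rewrite (surjective_pairing (a l)) al0 al20.
    case: (gp _ _ kl ((a k).2 / (a l).2)).
    by rewrite al0 mulr0 divfK// -ak0 -surjective_pairing.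
  rewrite sE size_rem ?mem_enum// size_enum_ord => /leq_trans /(_ sP).
  by case: (n) mn => //= n'; rewrite ltnS => /leq_ltn_trans/[apply]; rewrite ltnn.
(* [B] is a left inverse of [M]; its row of index [j] expresses x^(m-j) y^j, which is x^i y^j. *)
have /row_fullP[B BM] := fullM.
exists (B (inord j)) => x y.
pose k0 : 'I_m.+1 := inord j.
have jm : (j < m.+1)%N by rewrite ltnS leq_addl.
transitivity (\sum_(k < m.+1) (B *m M) k0 k * (x ^+ (m - k) * y ^+ k)).
  rewrite BM (bigD1 k0)//= big1 ?addr0 => [|k kk0]; last first.
    by rewrite mxE eq_sym (negPf kk0) mul0r.
  by rewrite mxE eqxx mul1r /k0 inordK// /m addnK.
under eq_bigr => k _ do rewrite mxE mulr_suml.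
rewrite exchange_big; apply: eq_bigr => l _ /=.
rewrite exprDn mulr_sumr; apply: eq_bigr => k _.
rewrite mxE !exprMn -mulrA; congr (_ * _).
by rewrite mulrnAl mulrACA.
Qed.

(** * Taylor approximation of real-analytic functions *)

Lemma summable_square_le (R : realType) (f : nat * nat -> R) :
  summable [set: nat * nat] (fun ij => (f ij)%:E) ->
  exists M : R, forall N : nat,
    \sum_(i < N) \sum_(j < N) `|f (i : nat, j : nat)| <= M.
Proof.
move=> sf; exists (fine (\esum_(x in [set: nat * nat]) `|(f x)%:E|)%E) => N.
rewrite -lee_fin fineK; last by rewrite -summableE.
pose s := [seq (i, j) | i <- index_iota 0 N, j <- index_iota 0 N].
have sU : uniq s.
  by apply: allpairs_uniq; rewrite ?iota_uniq// => -[i j] [k l] _ _ [-> ->].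
apply: esum_ge; exists [set` s]; first by split => //; exact: finite_seq.
rewrite -fsbig_seq//= big_allpairs_dep/= -sumEFin big_mkord le_eqVlt.
apply/orP; left; apply/eqP; apply: eq_bigr => i _.
by rewrite -sumEFin big_mkord.
Qed.

(** Every discarded monomial has degree at least [n], so for |h|, |k| <= d <= rho it is at most
    (d/rho)^n times its absolute value at (rho, rho), and these values have a finite sum. *)
Lemma analytic_taylor (R : realType) (n : nat) (S : R * R -> R) (z : R * R) :
  analytic_at S z ->
  exists (c : nat -> nat -> R) (rho M : R), [/\ 0 < rho, 0 < M &
    forall h k d : R, d <= rho -> `|h| <= d -> `|k| <= d ->
      `|S (z.1 + h, z.2 + k) -
        \sum_(i < n) \sum_(j < n | (i + j < n)%N) c i j * h ^+ i * k ^+ j|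
      <= M * d ^+ n].
Proof.
move=> [c [r [r0 Sc]]]; exists c.
(* Staying strictly inside the radius [r] makes the series absolutely summable at the corner (rho,
   rho) itself. *)
pose rho := r / 2; have rho0 : 0 < rho by rewrite divr_gt0.
have rhor : rho < r by rewrite /rho ltr_pdivrMr// ltr_pMr// ltr1n.
have nrho : `|rho| < r by rewrite gtr0_norm.
have [M0 HM0] := summable_square_le (proj1 (Sc rho rho nrho nrho)).
have M0_ge0 : 0 <= M0 by have := HM0 0%N; rewrite big_ord0.
(* The added 1 keeps the constant positive even if [M0] is 0. *)
exists rho, (M0 / rho ^+ n + 1); split => //.
  by rewrite ltr_wpDl// divr_ge0// exprn_ge0// ltW.
move=> h k d drho hd kd; have d0 : 0 <= d := le_trans (normr_ge0 _) hd.
have [_ cvS] := Sc h k (le_lt_trans (le_trans hd drho) rhor)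
                       (le_lt_trans (le_trans kd drho) rhor).
set T := \sum_(i < n) _.
have cvST : (fun N => `|\sum_(i < N) \sum_(j < N) c i j * h ^+ i * k ^+ j - T|)
    @ \oo --> `|S (z.1 + h, z.2 + k) - T|.
  by apply: cvg_norm; apply: cvgB => //; exact: cvg_cst.
(* The bound is proved for square partial sums with [N] at least [n], uniformly in [N], and passes
   to the limit. *)
apply: (cvgr_to_le cvST); near=> N.
have nN : (n <= N)%N by near: N; exact: nbhs_infty_ge.
have TE : T = \sum_(i < N) \sum_(j < N | (i + j < n)%N) c i j * h ^+ i * k ^+ j.
  rewrite /T (big_ord_widen N (fun i => \sum_(j < n | (i + j < n)%N)
    c i j * h ^+ i * k ^+ j))// big_mkcond; apply: eq_bigr => i _.
  case: ifPn => [_|]; last first.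
    rewrite -leqNgt => ni; rewrite big1// => j.
    by rewrite ltnNge (leq_trans ni) ?leq_addr.
  rewrite (big_ord_widen_cond N (fun j => (i + j < n)%N)
    (fun j => c i j * h ^+ i * k ^+ j))//.
  apply: eq_bigl => j; rewrite andb_idr// => ijn.
  exact: leq_ltn_trans (leq_addl _ _) ijn.
have -> : \sum_(i < N) \sum_(j < N) c i j * h ^+ i * k ^+ j - T =
    \sum_(i < N) \sum_(j < N | ~~ (i + j < n)%N) c i j * h ^+ i * k ^+ j.
  rewrite TE -sumrB; apply: eq_bigr => i _.
  by rewrite (bigID (fun j : 'I_N => (i + j < n)%N))/= addrAC subrr add0r.
apply: (@le_trans _ _ (M0 / rho ^+ n * d ^+ n)); last first.
  by rewrite ler_wpM2r ?exprn_ge0// lerDl.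
apply: (le_trans (ler_norm_sum _ _ _)).
apply: (@le_trans _ _ ((d / rho) ^+ n *
    \sum_(i < N) \sum_(j < N) `|c i j * rho ^+ i * rho ^+ j|)); last first.
  rewrite expr_div_n mulrC [leRHS]mulrAC mulrA.
  by rewrite ler_wpM2r ?invr_ge0 ?exprn_ge0 ?(ltW rho0)// ler_wpM2r ?exprn_ge0.
rewrite mulr_sumr; apply: ler_sum => i _.
apply: (le_trans (ler_norm_sum _ _ _)).
rewrite mulr_sumr big_mkcond/=; apply: ler_sum => j _.
have q0 : 0 <= d / rho by rewrite divr_ge0// ltW.
case: ifPn => [|_]; last by rewrite mulr_ge0// exprn_ge0.
rewrite -leqNgt => nij; rewrite !normrM !normrX !(gtr0_norm rho0).
have q1 : d / rho <= 1 by rewrite ler_pdivrMr// mul1r.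
apply: (@le_trans _ _ (`|c i j| * d ^+ i * d ^+ j)).
  rewrite ler_pM ?mulr_ge0 ?exprn_ge0// ?lerXn2r ?nnegrE//.
  by rewrite ler_wpM2l// lerXn2r ?nnegrE.
have -> : `|c i j| * d ^+ i * d ^+ j =
    (d / rho) ^+ (i + j) * (`|c i j| * rho ^+ i * rho ^+ j).
  rewrite -!mulrA -!exprD mulrCA; congr (_ * _).
  by rewrite expr_div_n divfK// expf_neq0// gt_eqF.
by rewrite ler_wpM2r ?mulr_ge0 ?exprn_ge0 ?(ltW rho0)// ler_wiXn2l.
Unshelve. all: by end_near. Qed.

(** * Measurability in the plane and for complex-valued functions *)

(** The product sigma-algebra is generated by rectangles; an open set belongs to it as the countable
    union of the rational squares that it contains. *)
Lemma open_measurable_plane (R : realType) (U : set (R * R)) :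
  open U -> measurable (U : set (measurableTypeR R * measurableTypeR R)).
Proof.
move=> oU.
pose box (q : rat * rat * rat) : set (R * R) :=
  ball (ratr q.1.1 : R) (ratr q.2) `*` ball (ratr q.1.2 : R) (ratr q.2).
have -> : U = \bigcup_(q : rat * rat * rat)
    (if pselect (box q `<=` U) then box q else set0).
  apply/seteqP; split => [[x y] Uxy|z [q _]]; last first.
    by case: pselect => // qU; exact: qU.
  have [e /= e0 eU] : nbhs_ball (x, y) U by apply/nbhs_ballP; exact: open_nbhs_nbhs.
  (* With [r] below e/2, any two points of a square of radius [r] are within [e] in each coordinate,
     so a square containing (x, y) stays in the ball. *)
  have /rat_in_itvoo[r] : 0 < e / 2 by rewrite divr_gt0.
  rewrite in_itv/= => /andP[r0 re].
  have approx (t : R) : exists q : rat, `|ratr q - t| < ratr r.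
    have /rat_in_itvoo[q] : t - ratr r < t + ratr r.
      by rewrite ltrD2l (lt_trans _ r0)// oppr_lt0.
    by rewrite in_itv/= -ltr_distlC distrC; exists q.
  have [q1 q1x] := approx x; have [q2 q2y] := approx y.
  exists ((q1, q2), r) => //; case: pselect => [bU|]; first by split.
  case=> -[x' y'] [/= q1x' q2y']; apply: eU.
  rewrite /ball/= in q1x q2y q1x' q2y'.
  have near2 (s t q : R) : `|q - s| < ratr r -> `|q - t| < ratr r -> `|s - t| < e.
    move=> qs qt; rewrite -(subrKA q) (le_lt_trans (ler_normD _ _))//.
    by rewrite (splitr e) ltrD// (lt_trans _ re)// distrC.
  by split; rewrite /ball/=; [exact: near2 q1x q1x'|exact: near2 q2y q2y'].
apply: countable_bigcupT_measurable => // -[[q1 q2] r].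
case: pselect => bU //=; apply: measurableX; exact: measurable_ball.
Qed.

Lemma continuous_measurable_plane (R : realType) (f : R * R -> R) :
  continuous f ->
  measurable_fun [set: measurableTypeR R * measurableTypeR R] f.
Proof.
move=> /continuousP cf; apply: (measurability _ (RGenOpens.measurableE R)).
move=> _ [_ [a [b ->] <-]]; rewrite setTI.
by apply: open_measurable_plane; apply: cf; exact: interval_open.
Qed.

Section ComplexMeasurable.
Context {d : measure_display} {T : measurableType d} {R : realType}.

Lemma cmeasurableM (f g : T -> R[i]) :
  cmeasurable f -> cmeasurable g -> cmeasurable (fun x => f x * g x).
Proof.
move=> [mf1 mf2] [mg1 mg2]; split.
- rewrite (_ : (fun x => _) = (fun x => complex.Re (f x) * complex.Re (g x) -
    complex.Im (f x) * complex.Im (g x))).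
    by apply: measurable_funB; exact: measurable_funM.
  by apply/funext => x; case: (f x) (g x) => [? ?] [? ?].
- rewrite (_ : (fun x => _) = (fun x => complex.Re (f x) * complex.Im (g x) +
    complex.Im (f x) * complex.Re (g x))).
    by apply: measurable_funD; exact: measurable_funM.
  by apply/funext => x; case: (f x) (g x) => [? ?] [? ?].
Qed.

Lemma cmeasurable_prod (n : nat) (f : 'I_n -> T -> R[i]) :
  (forall j, cmeasurable (f j)) -> cmeasurable (fun x => \prod_(j < n) f j x).
Proof.
elim: n f => [|n IH] f mf.
  by under eq_fun do rewrite big_ord0; split; exact: measurable_cst.
by under eq_fun do rewrite big_ord_recl; apply: cmeasurableM => //; exact: IH.
Qed.

Lemma cmeasurable_expi (h : T -> R) :
  measurable_fun setT h -> cmeasurable (fun x => expi (h x)).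
Proof.
move=> mh; split => /=.
- apply: (measurableT_comp (f := @cos R)) mh.
  by apply: continuous_measurable_fun; exact: continuous_cos.
- apply: (measurableT_comp (f := @sin R)) mh.
  by apply: continuous_measurable_fun; exact: continuous_sin.
Qed.

Lemma measurable_normc (f : T -> R[i]) :
  cmeasurable f -> measurable_fun setT (fun x => Normc.normc (f x)).
Proof.
move=> [mf1 mf2].
rewrite (_ : (fun x => _) = (fun x => Num.sqrt
    (complex.Re (f x) ^+ 2 + complex.Im (f x) ^+ 2))); last first.
  by apply/funext => x; case: (f x).
have msqrt : measurable_fun setT (@Num.sqrt R).
  by apply: continuous_measurable_fun; exact: sqrt_continuous.
apply: (measurableT_comp msqrt).
by apply: measurable_funD; exact: measurable_funX.
Qed.

End ComplexMeasurable.

Lemma cmeasurable_comp {d d'} {T : measurableType d} {T' : measurableType d'}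
    {R : realType} (f : T' -> R[i]) (g : T -> T') :
  cmeasurable f -> measurable_fun setT g -> cmeasurable (fun x => f (g x)).
Proof.
move=> [mf1 mf2] mg; split.
- exact: (measurableT_comp (f := fun x => complex.Re (f x))).
- exact: (measurableT_comp (f := fun x => complex.Im (f x))).
Qed.

(** * Bounds for complex integrals and norms *)

Lemma normr_Re_le (R : rcfType) (w : R[i]) : `|complex.Re w| <= Normc.normc w.
Proof.
by case: w => a b /=; rewrite -sqrtr_sqr ler_wsqrtr// lerDl sqr_ge0.
Qed.

Lemma normr_Im_le (R : rcfType) (w : R[i]) : `|complex.Im w| <= Normc.normc w.
Proof.
by case: w => a b /=; rewrite -sqrtr_sqr ler_wsqrtr// lerDr sqr_ge0.
Qed.

Lemma sqr_Re_Im_gt0 (R : realDomainType) (w : R[i]) :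
  w != 0 -> 0 < complex.Re w ^+ 2 + complex.Im w ^+ 2.
Proof.
case: w => a b; rewrite eq_complex/= => ab0.
rewrite lt_neqAle addr_ge0 ?sqr_ge0// andbT eq_sym paddr_eq0 ?sqr_ge0//.
by rewrite !expf_eq0.
Qed.

(** Cauchy-Schwarz in the plane: by Lagrange's identity the defect of the squares is (al y - be
    x)^2. *)
Lemma Re_Im_comb_le (R : rcfType) (al be : R) (w : R[i]) :
  al * complex.Re w + be * complex.Im w <=
  Num.sqrt (al ^+ 2 + be ^+ 2) * Normc.normc w.
Proof.
case: w => x y /=; apply: (le_trans (ler_norm _)).
rewrite -sqrtrM ?addr_ge0 ?sqr_ge0// -sqrtr_sqr ler_wsqrtr// -subr_ge0.
rewrite (_ : _ - _ = (al * y - be * x) ^+ 2) ?sqr_ge0//; ring.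
Qed.

Section CIntegral.
Context {d : measure_display} {T : measurableType d} {R : realType}.
Variable mu : {measure set T -> \bar R}.

Lemma integrable_scale_indic (D : set T) (B : R) :
  measurable D -> (mu D < +oo)%E ->
  mu.-integrable setT (EFin \o (fun x => B * \1_D x)).
Proof.
move=> mD Doo; rewrite (_ : _ \o _ = (fun x => B%:E * (\1_D x)%:E)%E)//.
apply: integrableZl => //; apply/integrableP; split.
  exact/measurable_EFinP/measurable_indic.
under eq_integral do rewrite gee0_abs ?lee_fin//.
by rewrite integral_indic// setIT.
Qed.

(* Pairing with al - i be turns the modulus of a complex integral into the
   integral of a real function that can be bounded below pointwise. *)
Lemma cintegral_lower_bound (g : T -> R[i]) (D E : set T) (B m al be : R) :
  measurable D -> (mu D < +oo)%E -> measurable E -> E `<=` D ->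
  cmeasurable g ->
  (forall x, Normc.normc (g x) <= B * \1_D x) ->
  (forall x, m * \1_E x <= al * complex.Re (g x) + be * complex.Im (g x)) ->
  abs_convergent mu g /\
  m * fine (mu E) <=
    Num.sqrt (al ^+ 2 + be ^+ 2) * Normc.normc (cintegral mu g).
Proof.
move=> mD Doo mE ED mg gB mg_le.
have Eoo : (mu E < +oo)%E.
  by rewrite (le_lt_trans _ Doo)// le_measure ?inE.
have iD := integrable_scale_indic B mD Doo.
have gB' x : `|B * \1_D x| = B * \1_D x.
  by rewrite ger0_norm// (le_trans _ (gB x))//; case: (g x) => *; exact: sqrtr_ge0.
have [mgr mgi] := mg.
have iRe : mu.-integrable setT (EFin \o (fun x => complex.Re (g x))).
  apply: (le_integrable _ _ _ iD) => //; first exact/measurable_EFinP.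
  by move=> x _; rewrite /= lee_fin gB' (le_trans (normr_Re_le _)).
have iIm : mu.-integrable setT (EFin \o (fun x => complex.Im (g x))).
  apply: (le_integrable _ _ _ iD) => //; first exact/measurable_EFinP.
  by move=> x _; rewrite /= lee_fin gB' (le_trans (normr_Im_le _)).
have iN : mu.-integrable setT (EFin \o (fun x => Normc.normc (g x))).
  apply: (le_integrable _ _ _ iD) => //.
    exact/measurable_EFinP/measurable_normc.
  move=> x _; rewrite /= lee_fin gB' ger0_norm//.
  by case: (g x) => *; exact: sqrtr_ge0.
split.
  split => //; have /integrableP[_] := iN.
  under eq_integral => x _ do rewrite /= ger0_norm
    ?(le_trans (normr_ge0 _) (normr_Re_le _))//.
  by [].
apply: le_trans (Re_Im_comb_le _ _ _) => /=.
rewrite -RintegralZl// -RintegralZl// -RintegralD//; last 2 first.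
- exact: (integrableZl _ _ iRe).
- exact: (integrableZl _ _ iIm).
have -> : m * fine (mu E) = \int[mu]_x (m * \1_E x).
  rewrite RintegralZl//; last first.
    have := integrable_scale_indic 1 mE Eoo.
    by apply: eq_integrable => // x _ /=; rewrite mul1r.
  by congr (_ * _); rewrite /Rintegral integral_indic// setIT.
apply: le_Rintegral => //; first exact: integrable_scale_indic.
exact: (integrableD measurableT (integrableZl measurableT al iRe)
  (integrableZl measurableT be iIm)).
Qed.

Lemma cLnorm_unimodular (p : \bar R) (D : set T) (w : R) (g : T -> R[i]) :
  (1 <= p)%E -> measurable D -> 0 < w -> mu D = w%:E ->
  (forall x, Normc.normc (g x) = \1_D x) ->
  cLnorm mu p g = (w `^ fine (p^-1))%:E.
Proof.
move=> p1 mD w0 muD gD; rewrite /cLnorm.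
rewrite (@eq_Lnorm _ _ _ _ _ _ (fun x => (\1_D x)%:E)); last by move=> x; rewrite gD.
rewrite Lnorm.unlock; case: p p1 => [r| |]//=.
- rewrite lee_fin => r1; have r0 : r != 0 by rewrite gt_eqF// (lt_le_trans _ r1).
  rewrite inver (negPf r0)/= (_ : (\int[mu]_x _)%E = w%:E) ?poweR_EFin//.
  rewrite -muD -[D in RHS]setIT -integral_indic//; apply: eq_integral => x _.
  rewrite indicE; case: (x \in D); rewrite /= ?normr1 ?powR1// normr0 powR0//.
(* For p = oo the exponent is 0 and the norm must be 1: the modulus never exceeds 1, and an
   essential supremum below 1 would put [D] inside a null set. *)
- move=> _; rewrite powRr0.
  have muT : (0 < mu setT)%E.
    apply: (@lt_le_trans _ _ (mu D)); first by rewrite muD lte_fin.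
    by rewrite le_measure ?inE.
  rewrite muT; apply/eqP; rewrite eq_le; apply/andP; split.
    apply/ess_supP; apply: nearW => x /=.
    by rewrite lee_fin ger0_norm// indicE; case: (_ \in _).
  rewrite leNgt; apply/negP => lt1.
  have [N [mN N0 DN]] := ess_sup_ge mu (abse \o (fun x => (\1_D x)%:E)).
  suff : (mu D <= mu N)%E by rewrite N0 muD lee_fin leNgt w0.
  rewrite le_measure ?inE// => x Dx; apply: DN => /=.
  by rewrite indicE mem_set//= normr1 => /le_lt_trans /(_ lt1); rewrite ltxx.
Qed.

End CIntegral.

(** * Comparison of the linear forms with the coordinates, and ridge approximation *)

(** The set where all packets are nonzero gets trapped between two squares of comparable size. As n
    >= 2, the case of degree 1 of [monomial_span] writes [h] and [k] as combinations of the forms;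
    the other inclusion is the triangle inequality. *)
Lemma linear_forms_equiv (R : realFieldType) (n : nat) (a : 'I_n -> R * R) :
  (2 <= n)%N -> (forall j, a j <> (0, 0)) ->
  (forall i j, i != j -> forall t : R, a i <> (t * (a j).1, t * (a j).2)) ->
  exists K : R, [/\ 1 <= K,
    forall h k w, (forall j, `|(a j).1 * h + (a j).2 * k| <= w) ->
      `|h| <= K * w /\ `|k| <= K * w &
    forall h k w, `|h| <= w / K -> `|k| <= w / K ->
      forall j, `|(a j).1 * h + (a j).2 * k| <= w].
Proof.
move=> n2 a0 gp.
have [b1 b1E] := @monomial_span _ _ _ a0 gp 1 0 n2.
have [b2 b2E] := @monomial_span _ _ _ a0 gp 0 1 n2.
pose K1 := \sum_l `|b1 l|; pose K2 := \sum_l `|b2 l|.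
pose K3 := \sum_l (`|(a l).1| + `|(a l).2|).
have K1_ge0 : 0 <= K1 by apply: sumr_ge0.
have K2_ge0 : 0 <= K2 by apply: sumr_ge0.
have K3_ge0 : 0 <= K3 by apply: sumr_ge0 => l _; rewrite addr_ge0.
(* One constant dominates the coefficient sums for both inclusions; the 1 ensures K >= 1. *)
exists (1 + K1 + K2 + K3); split; first by lra.
- move=> h k w hkw.
  have w0 : 0 <= w by apply: le_trans (hkw (Ordinal n2)).
  have comb (b : 'I_n -> R) : `|\sum_l b l * ((a l).1 * h + (a l).2 * k)| <=
      (\sum_l `|b l|) * w.
    apply: (le_trans (ler_norm_sum _ _ _)); rewrite mulr_suml.
    by apply: ler_sum => l _; rewrite normrM ler_wpM2l.
  split.
    have -> : h = \sum_l b1 l * ((a l).1 * h + (a l).2 * k).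
      by have := b1E h k; rewrite expr1 expr0 mulr1.
    by rewrite (le_trans (comb _))// ler_wpM2r// -/K1; lra.
  have -> : k = \sum_l b2 l * ((a l).1 * h + (a l).2 * k).
    by have := b2E h k; rewrite expr1 expr0 mul1r.
  by rewrite (le_trans (comb _))// ler_wpM2r// -/K2; lra.
- move=> h k w; set K := (X in w / X) => hw kw j.
  have K0 : 0 < K by rewrite /K; lra.
  have aK : `|(a j).1| + `|(a j).2| <= K.
    suff : `|(a j).1| + `|(a j).2| <= K3 by rewrite /K; lra.
    by rewrite /K3 (bigD1 j)//= lerDl sumr_ge0// => l _; rewrite addr_ge0.
  have wK : 0 <= w / K := le_trans (normr_ge0 _) hw.
  apply: (le_trans (ler_normD _ _)); rewrite !normrM.
  apply: (@le_trans _ _ ((`|(a j).1| + `|(a j).2|) * (w / K))).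
    by rewrite mulrDl lerD// ler_wpM2l.
  by rewrite (le_trans (ler_wpM2r wK aK))// mulrC divfK// gt_eqF.
Qed.

(** Each monomial of the Taylor polynomial is replaced by its expansion in powers of the linear
    forms, and the terms are regrouped by direction. *)
Lemma analytic_ridge_approx (R : realType) (n : nat) (a : 'I_n -> R * R)
    (S : R * R -> R) (z : R * R) :
  (forall j, a j <> (0, 0)) -> general_position a -> analytic_at S z ->
  exists (q : 'I_n -> {poly R}) (rho M : R), [/\ 0 < rho, 0 < M &
    forall h k d : R, d <= rho -> `|h| <= d -> `|k| <= d ->
      `|S (z.1 + h, z.2 + k) - \sum_j (q j).[(a j).1 * h + (a j).2 * k]|
      <= M * d ^+ n].
Proof.
move=> a0 gp /(analytic_taylor n)[c [rho [M [rho0 M0 HM]]]].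
have /choice[b bE] : forall ij : nat * nat, exists b : 'I_n -> R,
    (ij.1 + ij.2 < n)%N -> forall x y, x ^+ ij.1 * y ^+ ij.2 =
      \sum_l b l * ((a l).1 * x + (a l).2 * y) ^+ (ij.1 + ij.2).
  (* The zero family is a default for degrees at least [n], which never enter the sum. *)
  move=> [i j] /=; have [ijn|_] := ltnP (i + j) n; last by exists (fun=> 0).
  by have [b bE] := monomial_span a0 gp ijn; exists b.
exists (fun l => \sum_(i < n) \sum_(j < n | (i + j < n)%N)
  (c i j * b (i : nat, j : nat) l) *: 'X^(i + j)), rho, M; split => //.
move=> h k d drho hd kd; rewrite (le_trans _ (HM _ _ _ drho hd kd))//.
rewrite le_eqVlt; apply/orP; left; apply/eqP; congr (`|_ - _|).
under eq_bigr => l _ do rewrite horner_sum.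
rewrite exchange_big; apply: eq_bigr => i _ /=.
under eq_bigr => l _ do rewrite horner_sum.
rewrite exchange_big; apply: eq_bigr => j ijn /=.
rewrite -mulrA (bE (i : nat, j : nat) ijn) mulr_sumr; apply: eq_bigr => l _ /=.
by rewrite hornerZ hornerXn mulrA.
Qed.

(** * Wave packets and the measure of their supports *)

Section WavePacket.
Context {R : realType}.

Lemma expiD (s t : R) : expi (s + t) = expi s * expi t.
Proof.
rewrite /expi cosD sinD; congr (_ +i* _).
by rewrite addrC.
Qed.

Lemma normc_expi (t : R) : Normc.normc (expi t) = 1.
Proof. by rewrite /= cos2Dsin2 sqrtr1. Qed.

Lemma expi_sum (I : Type) (r : seq I) (P : pred I) (F : I -> R) :
  expi (\sum_(i <- r | P i) F i) = \prod_(i <- r | P i) expi (F i).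
Proof.
by apply: (big_morph _ expiD); rewrite /expi cos0 sin0.
Qed.

Definition packet (lambda w c : R) (q : {poly R}) (t : R) : R[i] :=
  expi (- lambda * q.[t - c]) * (\1_(`[c - w, c + w]%classic) t)%:C.

Lemma normc_packet lambda w c q t :
  Normc.normc (packet lambda w c q t) = \1_(`[c - w, c + w]%classic) t.
Proof.
rewrite /packet Normc.normcM normc_expi mul1r /= expr0n/= addr0.
by rewrite sqrtr_sqr ger0_norm.
Qed.

Lemma packet_in lambda w c q t :
  `|t - c| <= w -> packet lambda w c q t = expi (- lambda * q.[t - c]).
Proof.
move=> tcw; rewrite /packet indicE mem_set ?mulr1//=.
by rewrite in_itv/= -ler_distl.
Qed.

Lemma packet_out lambda w c q t :
  ~~ (`|t - c| <= w) -> packet lambda w c q t = 0.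
Proof.
move=> tcw; rewrite /packet indicE memNset ?mulr0//=.
by rewrite in_itv/= -ler_distl; exact/negP.
Qed.

Lemma cmeasurable_packet lambda w c q :
  cmeasurable (packet lambda w c q : measurableTypeR R -> R[i]).
Proof.
apply: cmeasurableM.
  apply: cmeasurable_expi; apply: measurable_funM => //.
  apply: (measurableT_comp (f := horner q)).
    by apply: continuous_measurable_fun; exact: continuous_horner.
  exact: measurable_funB.
split => /=; last exact: measurable_cst.
by apply: measurable_indic; exact: measurable_itv.
Qed.

End WavePacket.

Lemma leb1_ball (R : realType) (c w : R) : 0 < w ->
  leb1 `[c - w, c + w]%classic = (2 * w)%:E.
Proof.
move=> w0; rewrite /leb1 /= lebesgue_measure_itv/= lte_fin.
rewrite ifT; last by lra.
by rewrite -EFinB; congr (_%:E); ring.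
Qed.

Lemma leb2_square (R : realType) (c : R * R) (w : R) : 0 < w ->
  leb2 (`[c.1 - w, c.1 + w]%classic `*` `[c.2 - w, c.2 + w]%classic) =
  ((2 * w) ^+ 2)%:E.
Proof.
move=> w0; rewrite expr2 EFinM -{1}(leb1_ball c.1 w0) -(leb1_ball c.2 w0).
by apply: product_measure1E; exact: measurable_itv.
Qed.

Lemma near_box (R : realType) (z : R * R) (P : R * R -> Prop) :
  (\forall z' \near z, P z') ->
  exists2 r : R, 0 < r & forall h k : R, `|h| <= r -> `|k| <= r ->
    P (z.1 + h, z.2 + k).
Proof.
(* Balls of the product are squares; halving the radius leaves room for non-strict inequalities. *)
move=> /nbhs_ballP[e /= e0 eP]; exists (e / 2); first by rewrite divr_gt0.
move=> h k he ke; have e2 : e / 2 < e by rewrite ltr_pdivrMr// ltr_pMr// ltr1n.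
by apply: eP; split; rewrite /ball/= opprD addrA subrr add0r normrN;
  [exact: le_lt_trans he e2|exact: le_lt_trans ke e2].
Qed.

(** * The functional evaluated on packets *)

(** The modulations cancel the ridge part of the phase, leaving only the remainder times [phi] where
    all packets live, and 0 elsewhere. The large square serves to dominate the integrand, the small
    one to bound its integral below. *)
Lemma packet_lower_bound (R : realType) (n : nat) (a : 'I_n -> R * R)
    (phi : R * R -> R[i]) (S : R * R -> R) (p : 'I_n -> \bar R)
    (lambda K w B m al be : R) (z0 : R * R) (q : 'I_n -> {poly R})
    (f := fun j => packet lambda w (dot (a j) z0) (q j)) :
  (forall j, 1 <= p j)%E ->
  cmeasurable (phi : measurableTypeR R * measurableTypeR R -> R[i]) ->
  measurable_fun setT S ->
  0 < w -> 1 <= K ->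
  (forall h k, (forall j, `|(a j).1 * h + (a j).2 * k| <= w) ->
    `|h| <= K * w /\ `|k| <= K * w) ->
  (forall h k, `|h| <= w / K -> `|k| <= w / K ->
    forall j, `|(a j).1 * h + (a j).2 * k| <= w) ->
  (forall h k, `|h| <= K * w -> `|k| <= K * w ->
    let phase := lambda * (S (z0.1 + h, z0.2 + k) -
      \sum_j (q j).[(a j).1 * h + (a j).2 * k]) in
    let g := expi phase * phi (z0.1 + h, z0.2 + k) in
    Normc.normc g <= B /\ m <= al * complex.Re g + be * complex.Im g) ->
  0 <= m ->
  [/\ admissible a phi S lambda p f,
    forall j, cLnorm leb1 (p j) (f j) = ((2 * w) `^ fine ((p j)^-1))%:E &
    m * (2 * (w / K)) ^+ 2 <=
      Num.sqrt (al ^+ 2 + be ^+ 2) * Normc.normc (Lambda a phi S lambda f)].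
Proof.
move=> p1 mphi mS w0 K1 out inn Hg m0.
have K0 : 0 < K := lt_le_trans ltr01 K1.
have Kw0 : 0 < K * w by rewrite mulr_gt0.
have wK0 : 0 < w / K by rewrite divr_gt0.
pose sq r : set (R * R) :=
  `[z0.1 - r, z0.1 + r]%classic `*` `[z0.2 - r, z0.2 + r]%classic.
have sqP r z : sq r z <-> `|z.1 - z0.1| <= r /\ `|z.2 - z0.2| <= r.
  by rewrite /sq/= !in_itv/= -!ler_distl.
have msq r : measurable (sq r : set (measurableTypeR R * measurableTypeR R)).
  by apply: measurableX; exact: measurable_itv.
have dotB j z : dot (a j) z - dot (a j) z0 =
    (a j).1 * (z.1 - z0.1) + (a j).2 * (z.2 - z0.2) by rewrite /dot; ring.
have zE z : z = (z0.1 + (z.1 - z0.1), z0.2 + (z.2 - z0.2)).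
  by rewrite !subrKC -surjective_pairing.
pose reg z := [forall j, `|dot (a j) z - dot (a j) z0| <= w].
have regP z : reg z -> sq (K * w) z.
  move=> /forallP rz; apply/sqP; apply: out => j.
  by rewrite -dotB.
have sq_reg z : sq (w / K) z -> reg z.
  move=> /sqP[h1 h2]; apply/forallP => j; rewrite dotB; exact: inn.
have F_in z : reg z -> integrand a phi S lambda f z =
    expi (lambda * (S z - \sum_j (q j).[(a j).1 * (z.1 - z0.1) +
      (a j).2 * (z.2 - z0.2)])) * phi z.
  move=> /forallP rz; rewrite /integrand.
  under eq_bigr => j _ do rewrite /f packet_in// dotB.
  by rewrite -expi_sum -expiD -mulr_sumr mulrBr mulNr.
have F_out z : ~~ reg z -> integrand a phi S lambda f z = 0.
  rewrite negb_forall => /existsP[j hj].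
  by rewrite /integrand (bigD1 j)//= /f packet_out// mul0r mulr0 mul0r.
have mf j : cmeasurable (f j : measurableTypeR R -> R[i]).
  exact: cmeasurable_packet.
have mdot j : measurable_fun setT
    (dot (a j) : measurableTypeR R * measurableTypeR R -> measurableTypeR R).
  have m1 : measurable_fun setT
      (@fst (measurableTypeR R) (measurableTypeR R)) by exact: measurable_fst.
  have m2 : measurable_fun setT
      (@snd (measurableTypeR R) (measurableTypeR R)) by exact: measurable_snd.
  by apply: measurable_funD; apply: measurable_funM.
have mF : cmeasurable (integrand a phi S lambda f :
    measurableTypeR R * measurableTypeR R -> R[i]).
  apply: cmeasurableM => //; apply: cmeasurableM.
    by apply: cmeasurable_expi; apply: measurable_funM.
  by apply: cmeasurable_prod => j; exact: (cmeasurable_comp (mf j) (mdot j)).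
have Hg' z : sq (K * w) z -> _ := fun zs =>
  Hg (z.1 - z0.1) (z.2 - z0.2) (proj1 ((sqP _ _).1 zs)) (proj2 ((sqP _ _).1 zs)).
have FB z : Normc.normc (integrand a phi S lambda f z) <= B * \1_(sq (K * w)) z.
  have [rz|rz] := boolP (reg z).
    rewrite F_in// indicE mem_set ?mulr1; last exact: regP.
    by have /= [] := Hg' z (regP z rz); rewrite -zE.
  rewrite F_out// Normc.normc0 indicE; have [zs|] := boolP (z \in _).
    have /= [+ _] := Hg' z (set_mem zs); rewrite mulr1; apply: le_trans.
    by case: (expi _ * _) => *; exact: sqrtr_ge0.
  by rewrite mulr0.
have Fm z : m * \1_(sq (w / K)) z <=
    al * complex.Re (integrand a phi S lambda f z) +
    be * complex.Im (integrand a phi S lambda f z).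
  (* Between the small square and the boundary of [reg] the left side is 0, and [0 <= m] makes the
     right side nonnegative. *)
  have [rz|rz] := boolP (reg z).
    rewrite F_in//; have /= [_] := Hg' z (regP z rz); rewrite -zE.
    by apply: le_trans; rewrite indicE; case: (_ \in _); rewrite ?mulr1 ?mulr0.
  rewrite F_out//= indicE memNset ?mulr0 ?addr0//.
  by move=> /sq_reg; exact/negP.
have [absF lowF] : abs_convergent leb2 (integrand a phi S lambda f) /\
    m * fine (leb2 (sq (w / K))) <= Num.sqrt (al ^+ 2 + be ^+ 2) *
      Normc.normc (Lambda a phi S lambda f).
  apply: (cintegral_lower_bound (msq (K * w))) => //.
  - by rewrite /sq leb2_square// ltry.
  - by move=> z /sq_reg/regP.
have nf j : cLnorm leb1 (p j) (f j) = ((2 * w) `^ fine ((p j)^-1))%:E.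
  have := @cLnorm_unimodular _ _ _ leb1 (p j)
    `[dot (a j) z0 - w, dot (a j) z0 + w]%classic (2 * w) (f j) (p1 j).
  apply; last by move=> t; rewrite normc_packet.
  - exact: measurable_itv.
  - by rewrite mulr_gt0.
  - exact: leb1_ball.
split => //; last by rewrite /sq leb2_square in lowF.
split => // j; split; first by split => //; rewrite nf ltry.
(* A packet has modulus 1 on an interval of length 2w, which no null set can contain. *)
move=> [N [mN N0 fN]].
pose I : set R := `[dot (a j) z0 - w, dot (a j) z0 + w]%classic.
suff : (leb1 I <= leb1 N)%E.
  by rewrite N0 leb1_ball// lee_fin leNgt mulr_gt0.
rewrite le_measure ?inE//; first exact: measurable_itv.
move=> t /= tI; apply: fN => /= ft0.
have := normc_packet lambda w (dot (a j) z0) (q j) t.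
rewrite -/(f j) ft0 Normc.normc0 indicE mem_set//= => /esym/eqP.
by rewrite oner_eq0.
Qed.

(** * Local control of the amplitude and of small phases *)

(** Rotation by [th] mixes the pairing along (al, be) with the transverse one; the constants fit
    because 3/4 * 3/4 - 1/16 = 1/2. *)
Lemma rotated_lower_bound (R : realType) (al be u v th : R) :
  3 / 4 <= cos th -> `|sin th| <= 1 / 16 ->
  3 / 4 * (al ^+ 2 + be ^+ 2) <= al * u + be * v ->
  `|be * u - al * v| <= al ^+ 2 + be ^+ 2 ->
  (al ^+ 2 + be ^+ 2) / 2 <=
    al * complex.Re (expi th * (u +i* v)) + be * complex.Im (expi th * (u +i* v)).
Proof.
set N := al ^+ 2 + be ^+ 2 => hc hs h1 h2.
have N0 : 0 <= N by rewrite addr_ge0 ?sqr_ge0.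
rewrite /= (_ : _ + _ = cos th * (al * u + be * v) + sin th * (be * u - al * v));
  last by ring.
have : - (1 / 16 * N) <= sin th * (be * u - al * v).
  by rewrite lerNl (le_trans (ler_norm _))// normrN normrM ler_pM.
have : 3 / 4 * (3 / 4 * N) <= cos th * (al * u + be * v).
  by rewrite ler_pM// ?mulr_ge0.
lra.
Qed.

Lemma cos_sin_near0 (R : realType) :
  exists2 eta : R, 0 < eta & forall t : R, `|t| <= eta ->
    3 / 4 <= cos t /\ `|sin t| <= 1 / 16.
Proof.
have h1 : \forall t \near (0 : R), 3 / 4 <= cos t.
  by apply: (cvgr_ge _ (@continuous_cos R 0)); rewrite cos0; lra.
have h2 : \forall t \near (0 : R), `|sin t| <= 1 / 16.
  by apply: (cvgr_norm_le _ (@continuous_sin R 0)); rewrite sin0 normr0; lra.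
have /nbhs_ballP[e /= e0 eP] : \forall t \near (0 : R),
    3 / 4 <= cos t /\ `|sin t| <= 1 / 16 by near=> t; split; near: t.
exists (e / 2); first by rewrite divr_gt0.
move=> t te; apply: eP; rewrite /ball/= sub0r normrN.
by rewrite (le_lt_trans te)// ltr_pdivrMr// ltr_pMr// ltr1n.
Unshelve. all: by end_near. Qed.

(** At [z0] the two pairings equal al^2 + be^2 > 0 and 0, so continuity gives nearby the hypotheses
    of [rotated_lower_bound]. *)
Lemma nonvanishing_near (R : realType) (phi : R * R -> R[i]) (z0 : R * R)
    (al := complex.Re (phi z0)) (be := complex.Im (phi z0)) :
  continuous (fun z => complex.Re (phi z)) ->
  continuous (fun z => complex.Im (phi z)) -> phi z0 != 0 ->
  exists B : R, \forall z \near z0, [/\ Normc.normc (phi z) <= B,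
    3 / 4 * (al ^+ 2 + be ^+ 2) <=
      al * complex.Re (phi z) + be * complex.Im (phi z) &
    `|be * complex.Re (phi z) - al * complex.Im (phi z)| <= al ^+ 2 + be ^+ 2].
Proof.
move=> cu cv phi0.
have N0 : 0 < al ^+ 2 + be ^+ 2 by exact: sqr_Re_Im_gt0.
exists (`|al| + 1 + (`|be| + 1)).
have cuv (s t : R) : (fun z => s * complex.Re (phi z) + t * complex.Im (phi z))
    @ z0 --> s * al + t * be.
  by apply: cvgD; (apply: cvgM; first exact: cvg_cst); [exact: cu|exact: cv].
have h1 : \forall z \near z0, 3 / 4 * (al ^+ 2 + be ^+ 2) <=
      al * complex.Re (phi z) + be * complex.Im (phi z).
  by apply: (cvgr_ge _ (cuv al be)); rewrite -!expr2; lra.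
have h2 : \forall z \near z0,
    `|be * complex.Re (phi z) - al * complex.Im (phi z)| <= al ^+ 2 + be ^+ 2.
  have := cvgr_norm_le _ (cuv be (- al)) (al ^+ 2 + be ^+ 2).
  rewrite mulNr (mulrC be) subrr normr0 => /(_ _ N0).
  by apply: filterS => z; rewrite mulNr.
have h3 : \forall z \near z0, `|complex.Re (phi z)| <= `|al| + 1.
  by apply: (cvgr_norm_le _ (cu z0)); rewrite ltrDl.
have h4 : \forall z \near z0, `|complex.Im (phi z)| <= `|be| + 1.
  by apply: (cvgr_norm_le _ (cv z0)); rewrite ltrDl.
near=> z; split; last 2 first.
- by near: z.
- by near: z.
have : `|complex.Re (phi z)| <= `|al| + 1 by near: z.
have : `|complex.Im (phi z)| <= `|be| + 1 by near: z.
case: (phi z) => u v /= hv hu.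
have le_uv : Num.sqrt (u ^+ 2 + v ^+ 2) <= `|u| + `|v|.
  rewrite -[leRHS]ger0_norm ?addr_ge0// -sqrtr_sqr ler_wsqrtr//.
  by rewrite sqrrD !real_normK ?num_real// -addrA lerD2l lerDr mulrn_wge0// mulr_ge0.
by rewrite (le_trans le_uv)// lerD.
Unshelve. all: by end_near. Qed.

(** * Choice of the scale and final estimate *)

Lemma powR_sum (R : realType) (x : R) (I : Type) (r : seq I) (P : pred I)
    (F : I -> R) : 0 < x ->
  \prod_(i <- r | P i) x `^ F i = x `^ (\sum_(i <- r | P i) F i).
Proof.
move=> x0; rewrite (big_morph _ (id1 := 1) (op1 := *%R))//; last exact: powRr0.
by move=> s t; rewrite powRD// (gt_eqF x0) implybT.
Qed.

Theorem proposition3p1 (R : realType) (n : nat) (hn : (2 <= n)%N)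
  (p : 'I_n -> \bar R) (hp : forall j, (1 <= p j)%E)
  (hsum : (\sum_(j < n) (p j)^-1)%E = ((2 ^+ n - n%:R) / 2 ^+ n.-1)%:E)
  (phi : R * R -> R[i]) (hphi : test_function phi)
  (hphi0 : csupport phi (0, 0))
  (a : 'I_n -> R * R) (ha0 : forall j, a j <> (0, 0))
  (ha : general_position a)
  (S : R * R -> R) (hS : measurable_fun setT S)
  (hSan : \forall z \near ((0, 0) : R * R), analytic_at S z) :
  exists C : R, 0 < C /\
    forall lambda : R, 1 <= lambda ->
      ((C * `|lambda| `^ (- (2 ^+ n.-1)^-1))%:E <= opnorm a phi S lambda p)%E.
Proof.
(* [phi] may vanish at the origin, but the origin is in the closure of its nonzero set, so the
   neighbourhood of analyticity contains a suitable [z0]. *)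
have [z0 [phi0 San]] := hphi0 _ hSan.
have cRe : continuous (fun z => complex.Re (phi z)) by have [[]] := hphi.1 0%N.
have cIm : continuous (fun z => complex.Im (phi z)) by have [_ []] := hphi.1 0%N.
have mphi : cmeasurable (phi : measurableTypeR R * measurableTypeR R -> R[i]).
  by split; exact: continuous_measurable_plane.
pose al := complex.Re (phi z0); pose be := complex.Im (phi z0).
pose Q := al ^+ 2 + be ^+ 2.
have Q0 : 0 < Q by exact: sqr_Re_Im_gt0.
have [K [K1 Kout Kinn]] := linear_forms_equiv hn ha0 ha.
have [q [rho [M [rho0 M0 SM]]]] := analytic_ridge_approx ha0 ha San.
have [eta eta0 etaP] := cos_sin_near0 R.
have [B /near_box[r r0 phir]] := nonvanishing_near cRe cIm phi0.
have K0 : 0 < K := lt_le_trans ltr01 K1.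
have n0 : (0 < n)%N := ltnW hn.
(* The bound 1 gives eps^n <= eps; [rho / K] and [r / K] keep the square of half-side K w where the
   ridge approximation and the bounds on [phi] hold; the last term keeps the remaining phase below
   [eta]. *)
pose eps := Num.min 1 (Num.min (rho / K) (Num.min (r / K) (eta / (M * K ^+ n)))).
have MK0 : 0 < M * K ^+ n by rewrite mulr_gt0// exprn_gt0.
have eps0 : 0 < eps by rewrite !lt_min ltr01 !divr_gt0.
have eps1 : eps <= 1 by rewrite ge_min lexx.
have epsrho : K * eps <= rho by rewrite mulrC -ler_pdivlMr// !ge_min lexx orbT.
have epsr : K * eps <= r by rewrite mulrC -ler_pdivlMr// !ge_min lexx !orbT.
have epseta : M * K ^+ n * eps ^+ n <= eta.
  apply: (@le_trans _ _ (M * K ^+ n * eps)).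
    by rewrite ler_pM2l// -[leRHS]expr1 ler_wiXn2l// ltW.
  by rewrite mulrC -ler_pdivlMr// !ge_min lexx !orbT.
pose e : R := 2 ^+ n.-1; have e0 : 0 < e by rewrite exprn_gt0.
(* The packet bound with [m = Q / 2] gives |Lambda| >= sqrt Q / (2 K^2) * (2w)^2. Dividing by the
   norms leaves (2w)^(n/e), whose part independent of [lambda] is the last factor. *)
pose C := Num.sqrt Q / (2 * K ^+ 2) * (2 * eps) `^ (n%:R / e).
have C0 : 0 < C.
  by rewrite !mulr_gt0 ?invr_gt0 ?mulr_gt0 ?sqrtr_gt0 ?exprn_gt0 ?powR_gt0 ?mulr_gt0.
exists C; split => // lambda lambda1.
have lambda0 : 0 < lambda := lt_le_trans ltr01 lambda1.
rewrite gtr0_norm//.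
pose w := eps * lambda `^ (- n%:R^-1).
have w0 : 0 < w by rewrite mulr_gt0// powR_gt0.
have nR0 : n%:R != 0 :> R by rewrite pnatr_eq0 -lt0n.
have weps : w <= eps.
  rewrite -[leRHS]mulr1 ler_pM2l// -[leRHS](powRr0 lambda).
  by apply: ler_powR => //; rewrite oppr_le0 invr_ge0.
have wn : w ^+ n = eps ^+ n / lambda.
  rewrite exprMn; congr (_ * _).
  by rewrite -powR_mulrn ?powR_ge0// -powRrM mulNr mulVf// powR_inv1// ltW.
have Kweps : K * w <= K * eps by rewrite ler_pM2l.
have [h k hw kw|adm nrm low] := @packet_lower_bound R n a phi S p lambda K w B
  (Q / 2) al be z0 q hp mphi hS w0 K1 (fun h k => Kout h k w)
  (fun h k => Kinn h k w) _ (divr_ge0 (ltW Q0) (ler0n _ 2)).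
  have [phiB phi1 phi2] := phir h k (le_trans hw (le_trans Kweps epsr))
    (le_trans kw (le_trans Kweps epsr)).
  have Sq := SM h k (K * w) (le_trans Kweps epsrho) hw kw.
  set th := lambda * _.
  (* The phase is at most lambda M (K w)^n = M K^n eps^n, the factor [lambda] cancelling against
     w^n. *)
  have [c1 c2] : 3 / 4 <= cos th /\ `|sin th| <= 1 / 16.
    apply: etaP; rewrite /th normrM gtr0_norm//.
    apply: (le_trans _ epseta); apply: (le_trans (ler_wpM2l (ltW lambda0) Sq)).
    rewrite exprMn wn !mulrA le_eqVlt; apply/orP; left; apply/eqP.
    by field; rewrite gt_eqF.
  rewrite /= Normc.normcM normc_expi mul1r; split => //.
  case: (phi (z0.1 + h, z0.2 + k)) phi1 phi2 => u v /= phi1 phi2.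
  exact: rotated_lower_bound.
set f := fun j => _ in adm nrm low.
(* Finite reciprocals, 0 for p = oo included, let the exponent condition be read in the reals. *)
have finp j : ((p j)^-1)%E \is a fin_num.
  case: (p j) (hp j) => [s| |]//=; rewrite lee_fin => s1.
  by rewrite inver gt_eqF// (lt_le_trans _ s1).
have sumE : \sum_(j < n) fine ((p j)^-1)%E = 2 - n%:R / e.
  apply: EFin_inj; rewrite -sumEFin.
  under eq_bigr => j _ do rewrite fineK//.
  rewrite hsum; congr (_%:E).
  rewrite -[X in 2 ^+ X](prednK n0) exprS -/e mulrBl mulfK// gt_eqF//.
have prodE : (\prod_(j < n) cLnorm leb1 (p j) (f j))%E =
    ((2 * w) `^ (2 - n%:R / e))%:E.
  under eq_bigr => j _ do rewrite nrm.
  by rewrite prodEFin powR_sum ?sumE// mulr_gt0.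
have w20 : 0 < 2 * w by rewrite mulr_gt0.
rewrite /opnorm.
apply: le_trans; last first.
  apply: ereal_sup_ubound; exists f; first exact: adm.
  by [].
rewrite prodE inver gt_eqF ?powR_gt0// -EFinM lee_fin.
rewrite ler_pdivlMr ?powR_gt0//.
have pE : (2 * w) `^ (n%:R / e) = (2 * eps) `^ (n%:R / e) * lambda `^ (- e^-1).
  rewrite /w mulrA powRM ?powR_ge0 ?mulr_ge0// ?(ltW eps0)//; congr (_ * _).
  by rewrite -powRrM; congr (_ `^ _); field; rewrite nR0 gt_eqF.
have -> : C * lambda `^ (- e^-1) * (2 * w) `^ (2 - n%:R / e) =
    Num.sqrt Q / (2 * K ^+ 2) * (2 * w) ^+ 2.
  rewrite /C -(mulrA (Num.sqrt Q / _)) -pE -mulrA; congr (_ * _).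
  rewrite -powRD ?(gt_eqF w20) ?implybT// subrKC.
  by rewrite powR_mulrn// ltW.
have sQ0 : 0 < Num.sqrt Q by rewrite sqrtr_gt0.
(* [low] bounds sqrt Q times |Lambda|; multiplying by sqrt Q turns the goal into it, as (sqrt Q)^2 =
   Q. *)
rewrite -(ler_pM2l sQ0); apply: le_trans low.
rewrite le_eqVlt; apply/orP; left; apply/eqP.
rewrite -[in RHS](sqr_sqrtr (ltW Q0)); field.
by rewrite gt_eqF.
Qed.
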